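(* Let $\mathcal V$ be a Euclidean Jordan algebra and let $\Theta : \mathcal V \to \overline{\mathbb R} := [-\infty,+\infty]$ be a function. Let $F : \mathcal V \to \mathbb{R}$ be a weakly spectral function and let $\mathcal E\subseteq \mathcal V$ be a weakly spectral set. Let $a \in \mathcal V$ be such that $\Theta(a)$ is finite and $\partial_{\mathcal E}\Theta(a) \neq \emptyset$. Suppose that $a$ is a local maximizer of the map $$x\in \mathcal E \mapsto \Theta(x)+F(x)$$ (i.e. $a\in\mathcal E$ and $\Theta(a)+F(a)\ge \Theta(x)+F(x)$ for all $x\in\mathcal E$ in some neighborhood of $a$). Then $a$ operator commutes with each element of $\partial_{\mathcal E}\Theta(a)$.
   Context: A Euclidean Jordan algebra is a finite dimensional real inner product space $(\mathcal V,\langle\cdot,\cdot\rangle)$ with a bilinear product $\circ:\mathcal V\times\mathcal V\to\mathcal V$ that is commutative, satisfies the Jordan identity $x^2\circ(x\circ y)=x\circ(x^2\circ y)$ (with $x^2=x\circ x$), satisfies $\langle x\circ y,z\rangle=\langle y,x\circ z\rangle$ for all $x,y,z$, and (standing assumption) has a unit element $e$. For $a\in\mathcal V$, $L_a:\mathcal V\to\mathcal V$ is $L_ax=a\circ x$. Elements $a,b\in\mathcal V$ operator commute if $L_aL_b=L_bL_a$. $\operatorname{Aut}(\mathcal V)$ is the set of invertible linear maps $X:\mathcal V\to\mathcal V$ with $X(a\circ b)=Xa\circ Xb$ for all $a,b\in\mathcal V$. A set $\mathcal E\subseteq\mathcal V$ is weakly spectral if $x\in\mathcal E$ implies $Xx\in\mathcal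 E$ for all $X\in\operatorname{Aut}(\mathcal V)$. A function $F:\mathcal V\to\mathbb R$ is weakly spectral if $F(Xx)=F(x)$ for all $x\in\mathcal V$, $X\in\operatorname{Aut}(\mathcal V)$. For $S\subseteq\mathcal V$ and $a$ with $\Theta(a)$ finite, the (Fenchel) subdifferential of $\Theta$ at $a$ relative to $S$ is $$\partial_S\Theta(a):=\{v\in\mathcal V : \Theta(x)-\Theta(a)-\langle v,x-a\rangle\ge 0\ \text{ for all } x\in S\}.$$ *)

(* Defs.v *)
From HB Require Import structures.
From mathcomp Require Import all_boot all_order all_algebra.
From mathcomp Require Import boolp classical_sets reals constructive_ereal ereal.

Set Implicit Arguments.
Unset Strict Implicit.
Unset Printing Implicit Defensive.
Import Order.TTheory GRing.Theory Num.Theory.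
Local Open Scope classical_set_scope.
Local Open Scope ring_scope.

(* Over the reals, [{dot V for idfun}] is the type of symmetric bilinear
   positive definite forms, i.e. of inner products on V. *)
HB.mixin Record isEuclideanJordan (R : realType) V of Vector R V := {
  jdot : {dot V for (@idfun R)};
  jmul : {bilinear V -> V -> V};
  junit : V;
  jmulC : forall x y : V, jmul x y = jmul y x;
  jordan_identity : forall x y : V,
    jmul (jmul x x) (jmul x y) = jmul x (jmul (jmul x x) y);
  jdot_jmul : forall x y z : V, jdot (jmul x y) z = jdot y (jmul x z);
  jmul1 : forall x : V, jmul junit x = x
}.

#[short(type="euclideanJordanType")]
HB.structure Definition EuclideanJordan (R : realType) :=
  {V of isEuclideanJordan R V & Vector R V}.

Section Definitions.
Context {R : realType} {V : euclideanJordanType R}.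
Implicit Types (a b v x : V) (S E : set V).

Definition jnorm x : R := Num.sqrt (jdot x x).

Definition L a : 'End(V) := linfun (jmul a).

Lemma LE a x : L a x = jmul a x. Proof. exact: lfunE. Qed.

Definition operator_commute a b : Prop := (L a \o L b = L b \o L a)%VF.

Definition jordan_aut : set 'End(V) :=
  [set X : 'End(V) | bijective X /\ {morph X : a b / jmul a b}].

Definition weakly_spectral_set E : Prop :=
  forall X, jordan_aut X -> forall x, E x -> E (X x).

Definition weakly_spectral_fun (F : V -> R) : Prop :=
  forall X, jordan_aut X -> forall x, F (X x) = F x.

(* Meaningful only when [Theta a] is finite; the extended-real subtraction
   below then involves no indeterminate form. *)
Definition subdifferential S (Theta : V -> \bar R) a : set V :=
  [set v | forall x, S x ->
    (0 <= Theta x - Theta a - (jdot v (x - a))%:E)%E].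

Definition local_maximizer E (f : V -> \bar R) a : Prop :=
  E a /\ exists2 r : R, 0 < r &
    forall x, E x -> jnorm (x - a) < r -> (f x <= f a)%E.

End Definitions.

(* Main.v *)
(* If [X] is an automorphism and [X a] is close to [a], then [F (X a) = F a] and
   local maximality give [Theta (X a) <= Theta a], so the subgradient inequality
   gives [<v, X a - a> <= 0]. For a derivation [D] of the Jordan product, taking
   [X = exp (t D)] with [t] of either sign yields [<v, D a> = 0]. By the
   linearized Jordan identity [D = L x L y - L y L x] is a derivation; with it,
   [<v, D a> = 0] reads [<L a (L v x) - L v (L a x), y> = 0].

   The exponential is the limit of [P_N = \sum_(n < N) D^n / n!]. It is
   multiplicative because the terms of [P_N u o P_N v - P_N (u o v)] are
   dominated by those of [p_N(C)^2 - p_N(2 C)], where [p_N] is the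
   partial sum of the real exponential; this tends to [exp C ^ 2 - exp (2 C) = 0]. *)

Require Import Defs.
From HB Require Import structures.
From mathcomp Require Import all_boot all_order all_algebra.
From mathcomp Require Import boolp classical_sets reals constructive_ereal ereal.
From mathcomp Require Import topology normedtype sequences exp.
From mathcomp Require Import ring lra.
Set Implicit Arguments.
Unset Strict Implicit.
Unset Printing Implicit Defensive.
Import Order.TTheory GRing.Theory Num.Theory.
Import numFieldNormedType.Exports.
Local Open Scope classical_set_scope.
Local Open Scope ring_scope.

(** * Seminorms *)

Definition seminorm (R : numDomainType) (V : lmodType R) (q : V -> R) :=
  (forall x y, q (x + y) <= q x + q y) /\ (forall c x, q (c *: x) = `|c| * q x).

Section Seminorm.
Context {R : numDomainType} {V : lmodType R} {q : V -> R}.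
Hypothesis q_semi : seminorm q.

Lemma seminorm0 : q 0 = 0.
Proof. by rewrite -(scale0r 0) q_semi.2 normr0 mul0r. Qed.

Lemma seminormN x : q (- x) = q x.
Proof. by rewrite -scaleN1r q_semi.2 normrN1 mul1r. Qed.

Lemma seminorm_ge0 x : 0 <= q x.
Proof.
have := q_semi.1 x (- x); rewrite subrr seminorm0 seminormN -mulr2n.
by rewrite pmulrn_lge0.
Qed.

Lemma seminorm_sum I (r : seq I) (P : pred I) (F : I -> V) :
  q (\sum_(i <- r | P i) F i) <= \sum_(i <- r | P i) q (F i).
Proof.
elim/big_ind2: _ => [|x a y b xa yb|//]; first by rewrite seminorm0.
exact: le_trans (q_semi.1 _ _) (lerD xa yb).
Qed.

End Seminorm.

(** * The coordinate norm, bounds for linear and bilinear maps, and convergence *)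

Section Norm1.
Context {R : realType} {V : vectType R}.
Implicit Types (u v w l : V).

(** This is the l1 norm in a fixed basis. A bare [vectType] carries no norm, and with this one a map
    is bounded by its values on basis vectors. *)
Definition norm1 u : R :=
  \sum_(i < \dim {:V}) `|coord (vbasis fullv) i u|.

Lemma vbasis_expand u :
  u = \sum_(i < \dim {:V}) coord (vbasis fullv) i u *: (vbasis {:V})`_i.
Proof. exact: coord_vbasis (memvf u). Qed.

Lemma norm1_seminorm : seminorm norm1.
Proof.
split=> [x y|c x]; rewrite /norm1.
  rewrite -big_split; apply: ler_sum => i _; rewrite linearD; exact: ler_normD.
by rewrite mulr_sumr; apply: eq_bigr => i _; rewrite linearZ normrM.
Qed.

Lemma norm1D u v : norm1 (u + v) <= norm1 u + norm1 v.
Proof. exact: norm1_seminorm.1. Qed.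

Lemma norm1Z c u : norm1 (c *: u) = `|c| * norm1 u.
Proof. exact: norm1_seminorm.2. Qed.

Lemma norm1N u : norm1 (- u) = norm1 u.
Proof. exact: seminormN norm1_seminorm u. Qed.

Lemma norm1_ge0 u : 0 <= norm1 u.
Proof. exact: seminorm_ge0 norm1_seminorm u. Qed.

Lemma coord_le_norm1 i u : `|coord (vbasis fullv) i u| <= norm1 u.
Proof. by rewrite /norm1 (bigD1 i)//= lerDl sumr_ge0. Qed.

Lemma norm1_le0 u : norm1 u <= 0 -> u = 0.
Proof.
move=> u0; rewrite (vbasis_expand u) big1// => i _.
have := le_trans (coord_le_norm1 i u) u0.
by rewrite normr_le0 => /eqP ->; rewrite scale0r.
Qed.

(** Expanding [u] in the basis, subadditivity and homogeneity bound [q u] by the values of [q] on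
    basis vectors, weighted by coordinates. *)
Lemma seminorm_bounded (q : V -> R) : seminorm q ->
  exists2 C : R, 0 <= C & forall u, q u <= C * norm1 u.
Proof.
move=> q_semi; exists (\sum_(i < \dim {:V}) q (vbasis {:V})`_i).
  by apply: sumr_ge0 => i _; exact: seminorm_ge0.
move=> u; rewrite {1}(vbasis_expand u).
apply: le_trans (seminorm_sum q_semi _ _ _) _.
rewrite mulr_suml; apply: ler_sum => i _; rewrite q_semi.2 mulrC.
by rewrite ler_wpM2l ?coord_le_norm1 ?(seminorm_ge0 q_semi).
Qed.

(** Expanding [v] in the basis leaves the sum of [q u] over basis vectors, itself a seminorm in [u],
    to which [seminorm_bounded] applies. *)
Lemma seminorm2_bounded (q : V -> V -> R) :
    (forall u, seminorm (q u)) -> (forall v, seminorm (q^~ v)) ->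
  exists2 C : R, 0 <= C & forall u v, q u v <= C * norm1 u * norm1 v.
Proof.
move=> q_semir q_semil.
have sum_semi : seminorm (fun u => \sum_(i < \dim {:V}) q u (vbasis {:V})`_i).
  split=> [x y|c x].
    by rewrite -big_split; apply: ler_sum => i _; apply: (q_semil _).1.
  by rewrite mulr_sumr; apply: eq_bigr => i _; apply: (q_semil _).2.
have [C C0 qC] := seminorm_bounded sum_semi; exists C => // u v.
apply: le_trans (ler_wpM2r (norm1_ge0 v) (qC u)).
rewrite {1}(vbasis_expand v).
apply: le_trans (seminorm_sum (q_semir u) _ _ _) _.
rewrite mulr_suml; apply: ler_sum => i _; rewrite (q_semir u).2 mulrC.
by rewrite ler_wpM2l ?coord_le_norm1 ?(seminorm_ge0 (q_semir u)).
Qed.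

Lemma linear_bounded (f : {linear V -> V}) :
  exists2 C : R, 0 <= C & forall u, norm1 (f u) <= C * norm1 u.
Proof.
apply: seminorm_bounded; split=> [x y|c x]; first by rewrite linearD norm1D.
by rewrite linearZ norm1Z.
Qed.

Lemma bilinear_bounded (f : {bilinear V -> V -> V}) :
  exists2 C : R, 0 <= C & forall u v, norm1 (f u v) <= C * norm1 u * norm1 v.
Proof.
apply: seminorm2_bounded => u; split=> [x y|c x].
- by rewrite linearDr norm1D.
- by rewrite linearZr norm1Z.
- by rewrite linearDl norm1D.
- by rewrite linearZl_LR norm1Z.
Qed.

(** Convergence in [V] is expressed by a real null sequence, so only the topology of [R] enters. *)
Definition vcvg (u : nat -> V) l := norm1 (u n - l) @[n --> \oo] --> (0 : R).

Lemma vcvg_squeeze (u : nat -> V) l (e : nat -> R) :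
  (forall n, norm1 (u n - l) <= e n) -> e n @[n --> \oo] --> (0 : R) ->
  vcvg u l.
Proof.
move=> ue e0; apply: (squeeze_cvgr _ (cvg_cst 0) e0).
by apply: nearW => n; rewrite norm1_ge0 ue.
Qed.

Lemma vcvg_coord (u : nat -> V) l :
  (forall i, coord (vbasis fullv) i (u n) @[n --> \oo] -->
     (coord (vbasis fullv) i l : R)) -> vcvg u l.
Proof.
move=> ul; have : (\sum_(i < \dim {:V}) `|coord (vbasis fullv) i (u n - l)|)
    @[n --> \oo] --> \sum_(i < \dim {:V}) (0 : R).
  apply: cvg_big => [|i _]; first exact: add_continuous.
  rewrite -(normr0 R) -(subrr (coord (vbasis fullv) i l)); apply: cvg_norm.
  by under eq_fun do rewrite linearB; exact: cvgB (ul i) (cvg_cst _).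
by rewrite big1.
Qed.

Lemma vcvg_unique (u : nat -> V) l m : vcvg u l -> vcvg u m -> l = m.
Proof.
move=> ul um; apply/eqP; rewrite -subr_eq0; apply/eqP/norm1_le0.
rewrite -[leRHS](addr0 0) -(cvg_lim _ (cvgD ul um))//.
apply: limr_ge; first by apply/cvg_ex; exists (0 + 0); exact: cvgD ul um.
apply: nearW => n; rewrite [leRHS]/(norm1 (u n - l) + norm1 (u n - m)).
by have := norm1D (- (u n - l)) (u n - m); rewrite norm1N opprB addrA subrK.
Qed.

Lemma vcvg_norm1_le (u : nat -> V) l K :
  (forall n, norm1 (u n) <= K) -> vcvg u l -> norm1 l <= K.
Proof.
move=> uK ul; rewrite -subr_le0 -[leRHS](cvg_lim _ ul)//.
apply: limr_ge; first by apply/cvg_ex; exists 0.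
apply: nearW => n; rewrite lerBlDr -(norm1N (u n - l)).
rewrite -{1}(subrK (u n) l) opprB.
by apply: le_trans (norm1D _ _) _; rewrite lerD2l.
Qed.

Lemma vcvg_lincomb (c : R) (u v : nat -> V) l m :
  vcvg u l -> vcvg v m -> vcvg (fun n => c *: u n + v n) (c *: l + m).
Proof.
move=> ul vm.
apply: (@vcvg_squeeze _ _ (fun n => `|c| * norm1 (u n - l) + norm1 (v n - m))).
  move=> n; rewrite opprD addrACA -scalerBr -norm1Z; exact: norm1D.
rewrite -[X in _ --> X](addr0 0); apply: cvgD vm.
by rewrite -[0](mulr0 `|c|); exact: cvgM (cvg_cst _) ul.
Qed.

Lemma vcvg_bilinear (f : {bilinear V -> V -> V}) (u v : nat -> V) l m :
  vcvg u l -> vcvg v m -> vcvg (fun n => f (u n) (v n)) (f l m).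
Proof.
move=> ul vm; have [C C0 fC] := bilinear_bounded f.
pose e n := norm1 (u n - l); pose d n := norm1 (v n - m).
apply: (@vcvg_squeeze _ _
  (fun n => C * e n * (norm1 m + d n) + C * norm1 l * d n)).
  (* Change one argument at a time; [norm1 (v n)] is then bounded by [norm1 m + d n]. *)
  move=> n; have -> : f (u n) (v n) - f l m = f (u n - l) (v n) + f l (v n - m).
    by rewrite linearBl linearBr addrA subrK.
  apply: le_trans (norm1D _ _) _; apply: lerD; last exact: fC.
  apply: le_trans (fC _ _) _; apply: ler_wpM2l.
    by rewrite mulr_ge0 ?norm1_ge0.
  by rewrite -[in leLHS](subrKC m (v n)); exact: norm1D.
rewrite [X in _ --> X](_ : _ = C * 0 * (norm1 m + 0) + C * norm1 l * 0).
  2: by ring.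
apply: cvgD; last exact: cvgM (cvg_cst _) vm.
exact: cvgM (cvgM (cvg_cst _) ul) (cvgD (cvg_cst _) vm).
Qed.
End Norm1.

(** * Cauchy products and the real exponential series *)

Lemma sum_square_sub_triangle (W : zmodType) (g : nat -> nat -> W) N :
  \sum_(0 <= i < N) \sum_(0 <= j < N) g i j
    - \sum_(0 <= n < N) \sum_(0 <= k < n.+1) g k (n - k)%N =
  \sum_(0 <= i < N) \sum_(N - i <= j < N) g i j.
Proof.
(* The triangle [i + j < N], given by antidiagonals, is resummed by rows; removing it from the
   square leaves the corner [i + j >= N]. *)
have -> : \sum_(0 <= n < N) \sum_(0 <= k < n.+1) g k (n - k)%N =
    \sum_(0 <= i < N) \sum_(0 <= j < N - i) g i j.
  rewrite (eq_big_nat _ _ (F2 := fun n =>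
    \sum_(0 <= k < N | (k <= n)%N) g k (n - k)%N)).
    rewrite (exchange_big_dep_nat xpredT)//=.
    apply: eq_big_nat => i /andP[_ iN].
    rewrite -(@big_nat_widenl _ _ _ i 0 N xpredT)//.
    rewrite -[X in \sum_(X <= _ < _) _]add0n big_addn.
    by apply: eq_big_nat => j _; rewrite addnK.
  by move=> n /andP[_ nN]; rewrite (@big_nat_widen _ _ _ _ _ N).
rewrite -sumrB; apply: eq_big_nat => i /andP[_ iN].
by rewrite (@big_cat_nat _ _ _ (N - i) 0 N)//= ?leq_subr// addrAC subrr add0r.
Qed.

Section ExpCoeff.
Context {R : realType}.

Lemma exp_coeffD (x y : R) n :
  exp_coeff (x + y) n =
  \sum_(0 <= k < n.+1) exp_coeff x k * exp_coeff y (n - k)%N.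
Proof.
rewrite /exp_coeff/= addrC exprDn mulr_suml big_mkord.
apply: eq_bigr => -[k /= kn] _.
rewrite ltnS in kn; rewrite -mulr_natr -(bin_fact kn) !natrM.
have f0 m : m`!%:R != 0 :> R by rewrite pnatr_eq0 -lt0n fact_gt0.
have b0 : 'C(n, k)%:R != 0 :> R by rewrite pnatr_eq0 -lt0n bin_gt0.
by field; rewrite !f0 b0.
Qed.

(** The corner sum is the square of the partial sum at [x] minus the partial sum at [x + x]. *)
Lemma series_exp_coeff_square_cvg (x : R) :
  (\sum_(0 <= i < N) \sum_(N - i <= j < N) exp_coeff x i * exp_coeff x j)
    @[N --> \oo] --> (0 : R).
Proof.
rewrite (_ : (fun N => _) = (fun N => series (exp_coeff x) N
    * series (exp_coeff x) N - series (exp_coeff (x + x)) N)).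
  rewrite -(subrr (expR (x + x))) {1}expRD.
  apply: cvgB; last exact: is_cvg_series_exp_coeff.
  by apply: cvgM; exact: is_cvg_series_exp_coeff.
apply/funext => N.
rewrite -(sum_square_sub_triangle (fun i j => exp_coeff x i * exp_coeff x j)).
congr (_ - _); last by apply: eq_bigr => n _; rewrite exp_coeffD.
by rewrite /series/= mulr_suml; apply: eq_bigr => i _; rewrite mulr_sumr.
Qed.

Lemma series_exp_coeff_le (x : R) n :
  0 <= x -> series (exp_coeff x) n <= expR x.
Proof.
move=> x0; apply: nondecreasing_cvgn_le; last exact: is_cvg_series_exp_coeff.
by apply: nondecreasing_series => k _ _; exact: exp_coeff_ge0.
Qed.
End ExpCoeff.

(** * The exponential of an endomorphism *)

Section ExpEndomorphism.
Context {R : realType} {V : vectType R}.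
Implicit Types (D : 'End(V)) (u v : V).

Definition exp_term D n u : V := n`!%:R^-1 *: iter n D u.

Definition exp_partial D N u : V := \sum_(0 <= n < N) exp_term D n u.

Lemma exp_termP D n (c : R) u v :
  exp_term D n (c *: u + v) = c *: exp_term D n u + exp_term D n v.
Proof.
rewrite /exp_term scalerA mulrC -scalerA -scalerDr; congr (_ *: _).
by elim: n => //= n ->; rewrite linearP.
Qed.

Lemma exp_partialP D N (c : R) u v :
  exp_partial D N (c *: u + v) = c *: exp_partial D N u + exp_partial D N v.
Proof.
rewrite /exp_partial scaler_sumr -big_split.
by apply: eq_bigr => n _; exact: exp_termP.
Qed.

Lemma exp_termS D n u : D (exp_term D n u) = n.+1%:R *: exp_term D n.+1 u.
Proof.
rewrite /exp_term linearZ/= scalerA; congr (_ *: _).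
by rewrite factS natrM invfM mulrA divff ?mul1r ?pnatr_eq0.
Qed.

Lemma exp_termZ D (t : R) n u :
  exp_term (t *: D) n u = t ^+ n *: exp_term D n u.
Proof.
rewrite /exp_term scalerA mulrC -scalerA; congr (_ *: _).
elim: n => [|n IH]/=; first by rewrite expr0 scale1r.
by rewrite IH scale_lfunE linearZ/= scalerA exprS.
Qed.

Section Bound.
Context {D : 'End(V)} {C : R}.
Hypothesis C0 : 0 <= C.
Hypothesis DC : forall u, norm1 (D u) <= C * norm1 u.

Lemma norm1_exp_term n u : norm1 (exp_term D n u) <= exp_coeff C n * norm1 u.
Proof.
rewrite /exp_term /exp_coeff/= norm1Z ger0_norm ?invr_ge0// mulrAC mulrC.
apply: ler_wpM2r; first by rewrite invr_ge0.
elim: n => [|n IH]/=; first by rewrite expr0 mul1r.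
apply: le_trans (DC _) _; rewrite exprS -mulrA; exact: ler_wpM2l.
Qed.

Lemma exp_partial_cvg_ex u : exists l, vcvg (exp_partial D ^~ u) l.
Proof.
pose x i n : R := coord (vbasis fullv) i (exp_term D n u).
exists (\sum_i limn (series (x i)) *: (vbasis {:V})`_i).
apply: vcvg_coord => i; rewrite linear_sum/=.
rewrite (bigD1 i)//= big1 => [|j ji]; last first.
  by rewrite linearZ/= coord_free ?(basis_free (vbasisP _))// (negPf ji) mulr0.
rewrite addr0 linearZ/= coord_free ?(basis_free (vbasisP _))// eqxx mulr1.
under eq_fun do rewrite /exp_partial linear_sum.
(* [limn] is a genuine limit only once the series converges; comparison with the real exponential
   series at [C] gives absolute convergence. *)
suff : cvgn (series (x i)) by [].
apply: normed_cvg.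
have cexp := @is_cvg_seriesZ _ (exp_coeff C) (norm1 u)
  (@is_cvg_series_exp_coeff _ C).
apply: series_le_cvg cexp => n /=.
- exact: normr_ge0.
- by apply: mulr_ge0; [exact: norm1_ge0|exact: exp_coeff_ge0].
- apply: le_trans (coord_le_norm1 _ _) _.
  by apply: le_trans (norm1_exp_term _ _) _; rewrite mulrC.
Qed.

End Bound.

(** Choice collects the pointwise limits into a function, which is linear because the partial sums
    are and limits are unique. *)
Lemma exp_lfun_ex D :
  exists X : 'End(V), forall u, vcvg (exp_partial D ^~ u) (X u).
Proof.
have [C C0 DC] := linear_bounded D.
have [f fD] := choice (exp_partial_cvg_ex C0 DC).
have f_lin : linear f.
  move=> c u v; apply: vcvg_unique (fD _) _.
  under [X in vcvg X]eq_fun do rewrite exp_partialP; exact: vcvg_lincomb.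
pose F : {linear V -> V} := HB.pack f (GRing.isLinear.Build _ _ _ _ f f_lin).
by exists (linfun F) => u; rewrite lfunE; exact: fD.
Qed.

End ExpEndomorphism.

(** * Exponentials of derivations preserve the product *)

Section ExpDerivation.
Context {R : realType} {V : vectType R} (B : {bilinear V -> V -> V}).
Implicit Types (D : 'End(V)) (u v : V).

Definition derivation D := forall u v, D (B u v) = B (D u) v + B u (D v).

Lemma derivationZ t D : derivation D -> derivation (t *: D).
Proof.
move=> D_der u v.
by rewrite !scale_lfunE D_der scalerDr linearZl_LR linearZr.
Qed.

(** Leibniz rule for [D^n / n!], by induction. Applying [D] to the sum for [n] yields the product
    [g k] with coefficient [k + (n + 1 - k)], which is the factor [n + 1] of [exp_termS]. *)
Lemma exp_term_leibniz D n u v : derivation D ->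
  exp_term D n (B u v) =
  \sum_(0 <= k < n.+1) B (exp_term D k u) (exp_term D (n - k)%N v).
Proof.
move=> D_der; elim: n => [|n IH].
  by rewrite big_nat1 /exp_term/= fact0 invr1 !scale1r.
have n0 : n.+1%:R != 0 :> R by rewrite pnatr_eq0.
apply: (scalerI n0); rewrite -exp_termS IH linear_sum/=.
pose g k := B (exp_term D k u) (exp_term D (n.+1 - k)%N v).
have DB k : (0 <= k < n.+1)%N ->
    D (B (exp_term D k u) (exp_term D (n - k)%N v)) =
    k.+1%:R *: g k.+1 + (n.+1 - k)%:R *: g k.
  move=> /andP[_ kn]; rewrite D_der !exp_termS -subSn// /g subSS.
  by congr (_ + _); [exact: linearZl_LR|exact: linearZr].
rewrite (eq_big_nat _ _ DB) big_split/=.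
(* Both shifted sums extend to the range [k < n.+2], since the added terms, at [k = 0] and at
   [k = n.+1], have coefficient zero. *)
transitivity (\sum_(0 <= k < n.+2) (k%:R *: g k + (n.+1 - k)%:R *: g k)).
  rewrite [RHS]big_split/=; congr (_ + _).
    by rewrite [RHS]big_ltn// scale0r add0r big_add1.
  by rewrite [RHS]big_nat_recr//= subnn scale0r addr0.
rewrite scaler_sumr; apply: eq_big_nat => k /andP[_ kn].
by rewrite -scalerDl -natrD subnKC.
Qed.

Lemma exp_lfun_bilinear D (X : 'End(V)) u v : derivation D ->
  (forall w, vcvg (exp_partial D ^~ w) (X w)) -> X (B u v) = B (X u) (X v).
Proof.
move=> D_der XD; have [C C0 DC] := linear_bounded D.
have [K K0 BK] := bilinear_bounded B.
(* By the Leibniz rule, [r N] is the product of the partial sums at [u] and [v] minus the partial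
   sum at [B u v]. *)
pose r N : V := \sum_(0 <= i < N) \sum_(N - i <= j < N)
  B (exp_term D i u) (exp_term D j v).
have r0 : vcvg r 0.
  pose e N := K * norm1 u * norm1 v * (\sum_(0 <= i < N) \sum_(N - i <= j < N)
    exp_coeff C i * exp_coeff C j).
  apply: (@vcvg_squeeze _ _ _ _ e).
    move=> N; rewrite subr0 /e mulr_sumr.
    apply: le_trans (seminorm_sum norm1_seminorm _ _ _) _.
    apply: ler_sum => i _; rewrite mulr_sumr.
    apply: le_trans (seminorm_sum norm1_seminorm _ _ _) _.
    apply: ler_sum => j _; apply: le_trans (BK _ _) _.
    rewrite -[leLHS]mulrA.
    rewrite [leRHS](_ : _ = K * ((exp_coeff C i * norm1 u)
        * (exp_coeff C j * norm1 v))); last first.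
      by move: (exp_coeff C i) (exp_coeff C j) => a b; ring.
    by apply/ler_wpM2l/ler_pM; rewrite ?norm1_ge0 ?(norm1_exp_term C0 DC).
  rewrite -[X in _ --> X](mulr0 (K * norm1 u * norm1 v)).
  exact: cvgM (cvg_cst _) (series_exp_coeff_square_cvg C).
have := vcvg_bilinear B (XD u) (XD v).
rewrite (_ : (fun n => _) = (fun N => 1 *: r N + exp_partial D N (B u v))).
  move/(vcvg_unique (vcvg_lincomb 1 r0 (XD (B u v)))).
  by rewrite scaler0 add0r.
apply/funext => N; rewrite scale1r /r -sum_square_sub_triangle.
rewrite /exp_partial; under [X in _ + X]eq_bigr do rewrite exp_term_leibniz//.
rewrite subrK linear_sumlz; apply: eq_bigr => i _; exact: linear_sumr.
Qed.


(** For [X = exp (t D)] the remainder is the exponential series from [n = 2] on. As [|t| <= 1], a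
    factor [t ^+ 2] comes out of every term, and the rest sums to at most [expR C * norm1 u]. *)
Lemma derivation_flow D : derivation D ->
  exists2 K : R, 0 <= K & forall t : R, `|t| <= 1 ->
  exists X : 'End(V), {morph X : u v / B u v} /\
    forall u, norm1 (X u - u - t *: D u) <= t ^+ 2 * K * norm1 u.
Proof.
move=> D_der; have [C C0 DC] := linear_bounded D.
exists (expR C) => [|t t1]; first exact: expR_ge0.
have [X Xexp] := exp_lfun_ex (t *: D); exists X; split.
  by move=> u v; exact: exp_lfun_bilinear (derivationZ t D_der) Xexp.
(* Starting at [N.+2] terms ensures that the terms [u] and [t *: D u] are present and cancel. *)
move=> u; pose w N := exp_partial (t *: D) N.+2 u - u - t *: D u.
apply: (@vcvg_norm1_le _ _ w).
  move=> N; rewrite /w /exp_partial big_nat_recl// big_nat_recl//.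
  rewrite !exp_termZ.
  have -> : t ^+ 0 *: exp_term D 0 u = u.
    by rewrite /exp_term/= invr1 !scale1r.
  have -> : t ^+ 1 *: exp_term D 1 u = t *: D u.
    by rewrite /exp_term/= invr1 !scale1r.
  rewrite [u + _]addrC addrK [t *: D u + _]addrC addrK.
  apply: le_trans (seminorm_sum norm1_seminorm _ _ _) _.
  apply: (@le_trans _ _
    (\sum_(0 <= i < N) t ^+ 2 * (exp_coeff C i.+2 * norm1 u))).
    apply: ler_sum => i _; rewrite exp_termZ norm1Z.
    apply: ler_pM; rewrite ?norm1_ge0 ?(norm1_exp_term C0 DC)//.
    rewrite -[t ^+ 2]ger0_norm ?sqr_ge0// -addn2 exprD normrM.
    by rewrite ler_piMl// normrX exprn_ile1.
  rewrite -mulr_sumr -mulr_suml -mulrA ler_wpM2l ?sqr_ge0//.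
  (* Restoring the two missing nonnegative terms gives a full partial sum of the series for
     [expR C]. *)
  rewrite ler_wpM2r ?norm1_ge0//; apply: le_trans (series_exp_coeff_le N.+2 C0).
  rewrite /series/= [leRHS]big_nat_recl// [X in _ <= _ + X]big_nat_recl//.
  by rewrite addrA lerDr addr_ge0 ?exp_coeff_ge0.
have := Xexp u; rewrite /vcvg -(cvg_shiftn 2).
apply: cvg_trans; apply: near_eq_cvg; apply: nearW => n.
by rewrite /w/= addn2 opprB addrA subrK opprB addrA subrK.
Qed.

End ExpDerivation.

(** * The linearized Jordan identity, derivations and automorphisms *)

Lemma cubic_polarization (R : realFieldType) (V : zmodType)
    (f : V -> V -> V -> R) :
  (forall a b c d, f (a + b) c d = f a c d + f b c d) ->
  (forall a b c d, f c d (a + b) = f c d a + f c d b) ->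
  (forall a b c, f a b c = f b a c) ->
  (forall a, f a a a = 0) ->
  forall x y z, f x y z + f y z x + f z x y = 0.
Proof.
move=> fD1 fD3 fC f0 x y z.
have fD2 a b c d : f d (a + b) c = f d a c + f d b c.
  by rewrite fC fD1 fC (fC b).
(* Inclusion-exclusion over sums of subsets of the variables isolates the terms containing each of
   [x], [y], [z] once; symmetry in the first two arguments makes this twice the cyclic sum. *)
have : f (x + y + z) (x + y + z) (x + y + z) - f (x + y) (x + y) (x + y)
    - f (y + z) (y + z) (y + z) - f (x + z) (x + z) (x + z)
    + f x x x + f y y y + f z z z = 0.
  by rewrite !f0 !subr0 !addr0.
rewrite !(fD1, fD2, fD3) !(fC y x) !(fC z x) !(fC z y).
by lra.
Qed.

Section JordanDerivation.
Context {R : realType} {V : euclideanJordanType R}.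
Implicit Types x y z w : V.

Lemma jdotC x y : jdot x y = jdot y x.
Proof. by rewrite hermC expr0 mul1r. Qed.

(** Pairing with an arbitrary [u] turns identities in [V] into scalar ones, within reach of
    [lra]. *)
Lemma jdot_inj x y : (forall u, jdot u x = jdot u y) -> x = y.
Proof.
move=> xy; apply/eqP; rewrite -subr_eq0; apply: contraT.
by move=> /(@neq0_dnorm_gt0 _ _ _ jdot); rewrite linearBr/= xy subrr ltxx.
Qed.

(** This polarizes the Jordan identity, which is cubic in its first variable, with [w] held
    fixed. *)
Lemma jordan_linearized x y z w :
  jmul (jmul x y) (jmul z w) + jmul (jmul y z) (jmul x w)
    + jmul (jmul z x) (jmul y w) =
  jmul z (jmul (jmul x y) w) + jmul x (jmul (jmul y z) w)
    + jmul y (jmul (jmul z x) w).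
Proof.
apply: jdot_inj => u.
pose f x y z := jdot u (jmul (jmul x y) (jmul z w))
  - jdot u (jmul z (jmul (jmul x y) w)).
have : f x y z + f y z x + f z x y = 0.
  apply: cubic_polarization => [a b c d|a b c d|a b c|a]; rewrite /f.
  - by rewrite !(linearDl, linearDr)/= addrACA opprD.
  - by rewrite !(linearDl, linearDr)/= addrACA opprD.
  - by rewrite (jmulC a).
  - by rewrite jordan_identity subrr.
rewrite /f !linearDr/=.
move: (jdot u _) (jdot u _) (jdot u _) (jdot u _) (jdot u _) (jdot u _).
by move=> a b c d e g; lra.
Qed.

(* By [jordan_linearized], [z((xy)w) + x((yz)w) + y((zx)w)] is symmetric in all
   four variables. *)
Lemma derivation_commutator x y :
  derivation jmul ((L x \o L y) - (L y \o L x))%VF.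
Proof.
move=> z w; rewrite !(add_lfunE, opp_lfunE, comp_lfunE) !LE.
have sym : jmul z (jmul y (jmul x w)) + jmul x (jmul y (jmul z w))
      + jmul w (jmul y (jmul x z)) =
    jmul z (jmul x (jmul y w)) + jmul w (jmul x (jmul y z))
      + jmul y (jmul x (jmul z w)).
  have := jordan_linearized w y z x; have := jordan_linearized x w z y.
  rewrite !(jmulC _ y) !(jmulC _ x) (jmulC w z) (jmulC (jmul z w)).
  rewrite (jmulC (jmul y w)) (jmulC (jmul y z)) => <- <-.
  by rewrite addrC addrA.
rewrite (jmulC (_ - _)) !linearBr/=.
apply: jdot_inj => u; move/(congr1 (jdot u)): sym.
rewrite !(linearBr, linearDr)/=.
move: (jdot u _) (jdot u _) (jdot u _) (jdot u _) (jdot u _) (jdot u _).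
by move=> a b c d e g; lra.
Qed.

(** Invertibility for small [t] comes from the remainder bound: if [X u = 0], then [norm1 u] is at
    most [(t ^+ 2 * K + |t| * C) * norm1 u], hence at most half of itself. In finite dimension
    injectivity suffices. *)
Lemma derivation_aut (D : 'End(V)) : derivation jmul D ->
  exists2 K : R, 0 <= K & exists2 d : R, 0 < d & forall t : R, `|t| <= d ->
    exists2 X : 'End(V), jordan_aut X &
      forall u, norm1 (X u - u - t *: D u) <= t ^+ 2 * K * norm1 u.
Proof.
move=> /derivation_flow[K K0 flow]; have [C C0 DC] := linear_bounded D.
(* This radius forces both [|t| <= 1] and [|t| * (K + C) <= 1 / 2]. *)
have d0 : 0 < (2 * (K + C + 1))^-1 by rewrite invr_gt0; lra.
exists K => //; exists (2 * (K + C + 1))^-1 => // t td.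
have tKC : `|t| * (2 * (K + C + 1)) <= 1 by rewrite -ler_pdivlMr ?mul1r//; lra.
have t0 := normr_ge0 t.
have tKC0 : 0 <= `|t| * (K + C) by rewrite mulr_ge0 ?addr_ge0.
have t1 : `|t| <= 1 by lra.
have [X [Xmul Xt]] := flow t t1; exists X => //; split => //.
suff /lker0P Xinj : injective X.
  by exists (X^-1)%VF; [exact: lker0_lfunK|exact: lker0_lfunVK].
apply: raddf_inj => u Xu0; apply: norm1_le0.
have := norm1D (X u - u - t *: D u) (t *: D u).
rewrite subrK Xu0 sub0r norm1N norm1Z => uD.
have := Xt u; rewrite Xu0 sub0r => uX.
have := ler_wpM2l t0 (DC u); have := norm1_ge0 u.
move: uD uX; rewrite -(real_normK (num_real t)).
move: (norm1 (- u - _)) (norm1 u) (norm1 (D u)) => p n m uD uX n0 uC.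
have : 0 <= (1 - `|t|) * (`|t| * (K * n)).
  by apply: mulr_ge0; [lra|rewrite !mulr_ge0].
have : 0 <= (1 - 2 * (`|t| * (K + C))) * n by apply: mulr_ge0 => //; lra.
by lra.
Qed.

Lemma jdot_bounded :
  exists2 C : R, 0 <= C & forall u v : V, `|jdot u v| <= C * norm1 u * norm1 v.
Proof.
apply: (@seminorm2_bounded _ _ (fun u v => `|jdot u v|)) => u;
  split=> [x y|c x].
- by rewrite linearDr ler_normD.
- by rewrite linearZr_LR normrM.
- by rewrite linearDl ler_normD.
- by rewrite linearZl_LR normrM.
Qed.

(** Local maximality is measured in [jnorm], whereas the flow is estimated in [norm1]. *)
Lemma jnorm_bounded :
  exists2 C : R, 0 <= C & forall u : V, jnorm u <= C * norm1 u.
Proof.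
have [C C0 dotC] := jdot_bounded; exists (Num.sqrt C) => // u.
rewrite -[norm1 u]ger0_norm ?norm1_ge0// -sqrtr_sqr -sqrtrM//.
by apply: ler_wsqrtr; apply: le_trans (ler_norm _) _; rewrite expr2 mulrA.
Qed.

End JordanDerivation.

(** * The first-order condition and operator commutation *)

Lemma le_quadratic_eq0 (R : realFieldType) (c M d : R) : 0 < d ->
  (forall t : R, `|t| <= d -> t * c <= t ^+ 2 * M) -> c = 0.
Proof.
move=> d0 cM; apply/eqP; apply: contraT => c0.
have k0 : 0 < `|c| + `|M| * d by rewrite ltr_wpDr ?normr_gt0// mulr_ge0// ltW.
(* This [t] has the sign of [c] and size at most [d]; the hypothesis at [t] reduces to
   [|c| + |M| * d <= d * M], impossible for nonzero [c]. *)
pose t := d * c / (`|c| + `|M| * d).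
have td : `|t| <= d.
  rewrite !normrM normfV (gtr0_norm d0) (gtr0_norm k0) ler_pdivrMr//.
  by apply: (ler_wpM2l (ltW d0)); rewrite lerDl mulr_ge0// ltW.
have dc0 : 0 < d * c ^+ 2 by rewrite mulr_gt0// lt0r sqrf_eq0 c0 sqr_ge0.
have : d * c ^+ 2 * (`|c| + `|M| * d) <= d * c ^+ 2 * (d * M).
  have := ler_wpM2r (sqr_ge0 (`|c| + `|M| * d)) (cM _ td).
  rewrite [leLHS](_ : _ = d * c ^+ 2 * (`|c| + `|M| * d)); last first.
    by rewrite /t; field; rewrite gt_eqF.
  rewrite [leRHS](_ : _ = d * c ^+ 2 * (d * M))//.
  by rewrite /t; field; rewrite gt_eqF.
rewrite ler_pM2l// [d * M]mulrC => kM.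
have := ler_wpM2r (ltW d0) (ler_norm M); have : 0 < `|c| by rewrite normr_gt0.
by lra.
Qed.

Theorem theorem3 (R : realType) (V : euclideanJordanType R)
    (Theta : V -> \bar R) (F : V -> R) (E : set V) (a : V) :
  weakly_spectral_fun F ->
  weakly_spectral_set E ->
  Theta a \is a fin_num ->
  subdifferential E Theta a !=set0 ->
  local_maximizer E (fun x => (Theta x + (F x)%:E)%E) a ->
  forall v, subdifferential E Theta a v -> operator_commute a v.
Proof.
move=> F_spec E_spec a_fin _ [Ea [r r0 a_max]] v v_sub.
suff vD D : derivation jmul D -> jdot v (D a) = 0.
  (* Take [D = L x L y - L y L x] and move the multiplications across [jdot] until both sides are
     paired with [y]. *)
  apply/lfunP => x; rewrite !comp_lfunE !LE; apply: jdot_inj => y.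
  have := vD _ (derivation_commutator x y).
  rewrite !(add_lfunE, opp_lfunE, comp_lfunE) !LE linearBr/= => /subr0_eq.
  rewrite -[LHS]jdot_jmul (jmulC y a) -[LHS]jdot_jmul jdotC (jmulC x v) => ->.
  by rewrite -[LHS]jdot_jmul (jmulC y v) jdot_jmul (jmulC x a).
move=> D_der.
have [K K0 [d d0 flow]] := derivation_aut D_der.
have [C C0 DC] := linear_bounded D.
have [J J0 jdotJ] := @jdot_bounded R V.
have [N N0 jnormN] := @jnorm_bounded R V.
have le0 X : jordan_aut X -> jnorm (X a - a) < r -> jdot v (X a - a) <= 0.
  move=> Xaut Xr; have EX := E_spec _ Xaut _ Ea.
  have := a_max _ EX Xr; rewrite F_spec// leeD2rE// => Xa.
  have := v_sub _ EX; rewrite !sube_ge0// => vX.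
  by rewrite -lee_fin; apply: le_trans vX _; rewrite sube_le0.
(* For [|t| <= 1] the displacement [X a - a] has [jnorm] at most [|t| * B]. *)
pose B := N * (C + K) * norm1 a.
have B0 : 0 <= B by rewrite !mulr_ge0 ?addr_ge0 ?norm1_ge0.
(* The three bounds make [X] an automorphism, give [t ^+ 2 <= |t|], and keep [X a] in the ball of
   radius [r]; the [+ 1] avoids division by zero. *)
pose e := Num.min (Num.min d 1) (r / (2 * (B + 1))).
have e0 : 0 < e by rewrite !lt_min d0 ltr01 divr_gt0//; lra.
apply: (le_quadratic_eq0 (M := J * norm1 v * (K * norm1 a)) e0) => t.
rewrite !le_min => /andP[/andP[td t1] tr].
have [X Xaut /(_ a) Xt] := flow t td.
have Xr : jnorm (X a - a) < r.
  apply: le_lt_trans (jnormN _) _.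
  apply: (@le_lt_trans _ _ (`|t| * B)).
    rewrite (_ : `|t| * B = N * (`|t| * (C + K) * norm1 a)).
      2: by rewrite /B; ring.
    apply: ler_wpM2l => //.
    have := norm1D (X a - a - t *: D a) (t *: D a); rewrite subrK norm1Z => XD.
    have := ler_wpM2l (normr_ge0 t) (DC a).
    have : 0 <= (1 - `|t|) * (`|t| * (K * norm1 a)).
      by rewrite mulr_ge0 ?subr_ge0// !mulr_ge0 ?norm1_ge0.
    by move: Xt XD; rewrite -(real_normK (num_real t)); lra.
  have tB0 : 0 <= `|t| * B by rewrite mulr_ge0.
  have t0 := normr_ge0 t.
  by move: tr; rewrite ler_pdivlMr; lra.
(* Split [X a - a] into [t *: D a] and the remainder, whose pairing with [v] is at least
   [- (t ^+ 2 * M)] for the chosen [M]. *)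
have := le0 _ Xaut Xr; rewrite -{1}(subrK (t *: D a) (X a - a)).
rewrite linearDr linearZr/=.
have := jdotJ v (X a - a - t *: D a); rewrite ler_norml => /andP[+ _].
have := ler_wpM2l (mulr_ge0 J0 (norm1_ge0 v)) Xt.
by lra.
Qed.
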